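(* Let $R$ be a Noetherian Dubrovin valuation ring of a simple Artinian ring $A$, with $P=J(R)$. For $I\in\mathcal{F}(R)$ put $v(I)=(P:I)=\{a\in A\mid aI\subseteq P\}$ and let $\Gamma=\{v(I)\mid I\in\mathcal{F}(R)\}$. Then $v:\mathcal{F}(R)\to\Gamma$ is an arithmetical pseudo-valuation and $\Gamma$ is a totally ordered group. Furthermore, $$P=\{a\in A\mid v(RaR)>0\}\quad\text{and}\quad R=\{a\in A\mid v(RaR)\geq 0\}.$$
   Context: A Dubrovin valuation ring of a simple Artinian ring $A$ is a subring $R$ of $A$ such that $R/J(R)$ is simple Artinian ($J(R)$ the Jacobson radical) and for every $q\in A\setminus R$ there are $r,r'\in R$ with $rq\in R\setminus J(R)$ and $qr'\in R\setminus J(R)$. Such an $R$ is a prime Goldie ring and an order in $A$. Noetherian means left and right Noetherian. A fractional $R$-ideal of $A$ is an $R$-bimodule $I\subseteq A$ which contains a regular element of $R$ and satisfies $rI\subseteq R$ for some regular $r\in R$; $\mathcal{F}(R)$ is the set of fractional $R$-ideals. $\Gamma$ is given the operation $v(I)+v(J)=v(IJ)$, with neutral element $0=v(R)=P$, and the order $v(I)\leq v(J)\Leftrightarrow v(I)\subseteq v(J)$ (that these make $\Gamma$ a well-defined ordered group is part of the claim). An arithmetical pseudo-valuation on $R$ is a function $v:\mathcal{F}(R)\to\Gamma$, with $\Gamma$ a partially ordered semigroup, such that for all $I,J\in\mathcal{F}(R)$: (1) $v(IJ)=v(I)+v(J)$; (2) $v(I+J)\geq\min\{v(I),v(J)\}$;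 (3) $v(R)=0$; (4) $I\subseteq J$ implies $v(I)\geq v(J)$. By convention, $a=0$ is counted as satisfying $v(RaR)>0$. *)

(* Defs.v *)
From HB Require Import structures.
From mathcomp Require Import all_boot all_order all_algebra.
From mathcomp Require Import generic_quotient ring_quotient.
From mathcomp Require Import boolp classical_sets.

Set Implicit Arguments.
Unset Strict Implicit.
Unset Printing Implicit Defensive.

Import GRing.Theory.
Local Open Scope classical_set_scope.
Local Open Scope ring_scope.
Local Open Scope quotient_scope.

Section RingNotions.
Variable T : pzRingType.
Implicit Types I : set T.

Definition left_ideal I : Prop :=
  [/\ I 0, forall x y, I x -> I y -> I (x - y)
    & forall r x, I x -> I (r * x)].

Definition right_ideal I : Prop :=
  [/\ I 0, forall x y, I x -> I y -> I (x - y)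
    & forall r x, I x -> I (x * r)].

Definition dcc (C : set T -> Prop) : Prop :=
  forall u : nat -> set T, (forall n, C (u n)) ->
    (forall n, u n.+1 `<=` u n) ->
    exists N, forall n, (N <= n)%N -> u n = u N.

Definition acc (C : set T -> Prop) : Prop :=
  forall u : nat -> set T, (forall n, C (u n)) ->
    (forall n, u n `<=` u n.+1) ->
    exists N, forall n, (N <= n)%N -> u n = u N.

Definition artinian : Prop := dcc left_ideal /\ dcc right_ideal.

Definition noetherian : Prop := acc left_ideal /\ acc right_ideal.

Definition simple_ring : Prop :=
  (1 : T) <> 0 /\
  forall I, left_ideal I -> right_ideal I -> I = [set 0] \/ I = setT.

Definition simple_artinian : Prop := simple_ring /\ artinian.

Definition maximal_left_ideal M : Prop :=
  [/\ left_ideal M, M <> setT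
    & forall I, left_ideal I -> M `<=` I -> I = M \/ I = setT].

Definition jacobson : set T :=
  [set x | forall M, maximal_left_ideal M -> M x].

Definition regular (x : T) : Prop := GRing.lreg x /\ GRing.rreg x.

Lemma jacobsonB x y : jacobson x -> jacobson y -> jacobson (x - y).
Proof.
by move=> Jx Jy M maxM; have [[_ MB _] _ _] := maxM; apply: MB; [exact: Jx|exact: Jy].
Qed.

Lemma jacobsonMl r x : jacobson x -> jacobson (r * x).
Proof.
by move=> Jx M maxM; have [[_ _ MM] _ _] := maxM; apply: MM; exact: Jx.
Qed.

Lemma jacobsonMr x r : jacobson x -> jacobson (x * r).
Proof.
move=> Jx M maxM; have [[M0 MB MM] MT Mmax] := maxM.
have MD a b : M a -> M b -> M (a + b).
  by move=> Ma Mb; rewrite -[b]opprK -[- b]sub0r; apply: (MB) => //; exact: MB.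
have [Mr|nMr] := pselect (M r); first exact: MM.
apply: (Jx [set y | M (y * r)]); split.
- by split=> /= [|a b|a b]; rewrite ?mul0r ?mulrBl -?mulrA //; auto.
- by move=> E; apply: nMr; rewrite -[r]mul1r; have : setT (1 : T) by []; rewrite -E.
move=> I [I0 IB IM] sub.
have [leI|] := pselect (I `<=` [set y | M (y * r)]); first by left; rewrite eqEsubset.
move=> /existsNP [z /not_implyP[Iz nMz]]; right.
pose N := [set w | exists m i, [/\ M m, I i & w = m + i * r]].
have [||E|E] := Mmax N.
- split.
  + by exists 0, 0; split => //; rewrite mul0r addr0.
  + move=> _ _ [m [i [Mm Ii ->]]] [m' [i' [Mm' Ii' ->]]].
    exists (m - m'), (i - i'); split; [exact: MB|exact: IB|].
    by rewrite mulrBl opprD addrACA.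
  + move=> s _ [m [i [Mm Ii ->]]]; exists (s * m), (s * i).
    by split; [exact: MM|exact: IM|rewrite mulrDr mulrA].
- by move=> m Mm; exists m, 0; split => //; rewrite mul0r addr0.
- by case: nMz; rewrite /= -E; exists 0, z; split=> //; rewrite add0r.
rewrite -subTset => y _.
have : N (y * r) by rewrite E.
move=> [m [i [Mm Ii e]]].
have -> : y = (y - i) - (0 - i) by rewrite sub0r opprK subrK.
apply: (IB); last exact: IB.
by apply: sub; rewrite /= mulrBl e addrK.
Qed.

Definition jacobson_pred : {pred T} := fun x => `[< jacobson x >].

Lemma jacobson_predP x : reflect (jacobson x) (x \in jacobson_pred).
Proof. exact: asboolP. Qed.

Lemma jacobson_zmod_closed : zmod_closed jacobson_pred.
Proof.
split=> [|x y /jacobson_predP Jx /jacobson_predP Jy].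
  by apply/jacobson_predP => M [[]].
by apply/jacobson_predP; exact: jacobsonB.
Qed.

HB.instance Definition _ :=
  GRing.isZmodClosed.Build T jacobson_pred jacobson_zmod_closed.

(* The library only equips quotients of commutative rings with a product, so
   that of the quotient by the Jacobson radical is defined here. The result is
   a [pzRingType], as it may be trivial for a general [T]. *)
Definition jquot : Type := Quotient.quot jacobson_pred.

HB.instance Definition _ := GRing.Zmodule.on jquot.
HB.instance Definition _ := EqQuotient.on jquot.

Definition jquot_one : jquot := \pi_jquot 1.
Definition jquot_mul (x y : jquot) : jquot := \pi_jquot (repr x * repr y).

Lemma jquot_eqP (x y : T) :
  (\pi_jquot x = \pi_jquot y) <-> jacobson (x - y).
Proof.
have E := Quotient.idealrBE jacobson_pred x y.
split=> [/eqP e|/jacobson_predP Jxy]; first by apply/jacobson_predP; rewrite E.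
by apply/eqP; rewrite -E.
Qed.

Lemma jquot_pi_mul (x y : T) :
  jquot_mul (\pi_jquot x) (\pi_jquot y) = \pi_jquot (x * y).
Proof.
apply/jquot_eqP.
set x' := repr _; set y' := repr _.
have Jx : jacobson (x' - x) by apply/jquot_eqP; rewrite reprK.
have Jy : jacobson (y' - y) by apply/jquot_eqP; rewrite reprK.
have -> : x' * y' - x * y = (x' - x) * y' - x * (y - y').
  by rewrite mulrBl mulrBr opprB addrA subrK.
apply: jacobsonB; first exact: jacobsonMr.
apply: jacobsonMl; rewrite -opprB -sub0r; apply: jacobsonB => //.
by move=> M [[]].
Qed.

Fact jquot_mulA : associative jquot_mul.
Proof.
elim/quotW=> x; elim/quotW=> y; elim/quotW=> z.
rewrite (jquot_pi_mul y z) (jquot_pi_mul x y) (jquot_pi_mul x (y * z)).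
by rewrite (jquot_pi_mul (x * y) z) mulrA.
Qed.

Fact jquot_mul1q : left_id jquot_one jquot_mul.
Proof. by elim/quotW=> x; rewrite (jquot_pi_mul 1 x) mul1r. Qed.

Fact jquot_mulq1 : right_id jquot_one jquot_mul.
Proof. by elim/quotW=> x; rewrite (jquot_pi_mul x 1) mulr1. Qed.

Fact jquot_piD (x y : T) :
  \pi_jquot x + \pi_jquot y = \pi_jquot (x + y) :> jquot.
Proof. by rewrite [RHS](Quotient.pi_add jacobson_pred). Qed.

Fact jquot_mulDl : left_distributive jquot_mul +%R.
Proof.
elim/quotW=> x; elim/quotW=> y; elim/quotW=> z.
rewrite (jquot_piD x y) (jquot_pi_mul (x + y) z) (jquot_pi_mul x z).
by rewrite (jquot_pi_mul y z) jquot_piD mulrDl.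
Qed.

Fact jquot_mulDr : right_distributive jquot_mul +%R.
Proof.
elim/quotW=> x; elim/quotW=> y; elim/quotW=> z.
rewrite (jquot_piD y z) (jquot_pi_mul x (y + z)) (jquot_pi_mul x y).
by rewrite (jquot_pi_mul x z) jquot_piD mulrDr.
Qed.

HB.instance Definition _ := GRing.Zmodule_isPzRing.Build jquot
  jquot_mulA jquot_mul1q jquot_mulq1 jquot_mulDl jquot_mulDr.

End RingNotions.

Record subring_type (A : nzRingType) (R : subringClosed A) : Type :=
  SubringType { subring_val :> A; subring_valP : subring_val \in R }.

Section Subring.
Variables (A : nzRingType) (R : subringClosed A).
HB.instance Definition _ := [isSub for @subring_val A R].
HB.instance Definition _ := [Choice of subring_type R by <:].
HB.instance Definition _ :=
  [SubChoice_isSubNzRing of subring_type R by <:].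
End Subring.

(* [J(R)] as a subset of [A]. *)
Definition radical (A : nzRingType) (R : subringClosed A) : set A :=
  [set val x | x in @jacobson (subring_type R)].

Definition dubrovin_valuation_ring (A : nzRingType) (R : subringClosed A) :
    Prop :=
  simple_artinian (jquot (subring_type R)) /\
  forall q : A, q \notin R ->
    exists r r' : A, [/\ r \in R, r' \in R,
      (r * q \in R) /\ ~ radical R (r * q) &
      (q * r' \in R) /\ ~ radical R (q * r')].

Section FractionalIdeals.
Variables (A : nzRingType) (R : subringClosed A).
Local Notation P := (radical R).
Implicit Types (I J : set A) (a : A).

Definition bimodule I : Prop :=
  [/\ I 0, forall x y, I x -> I y -> I (x - y),
      forall r x, r \in R -> I x -> I (r * x)
    & forall r x, r \in R -> I x -> I (x * r)].

(* Regularity is tested in [R], i.e. against elements of [R] only. *)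
Definition fractional I : Prop :=
  [/\ bimodule I,
      exists2 r : subring_type R, regular r & I (val r)
    & exists2 r : subring_type R, regular r &
        forall x, I x -> val r * x \in R].

Definition prod_set I J : set A :=
  [set z | exists n (x y : 'I_n -> A), [/\ forall i, I (x i),
    forall i, J (y i) & z = \sum_(i < n) x i * y i]].

Definition sum_set I J : set A :=
  [set z | exists x y, [/\ I x, J y & z = x + y]].

Definition bimodule_gen a : set A :=
  [set z | exists n (r s : 'I_n -> subring_type R),
    z = \sum_(i < n) val (r i) * a * val (s i)].

Record frac_ideal : Type := FracIdeal
  { frac_carrier :> set A; fracP : fractional frac_carrier }.

Lemma regular1 : regular (1 : subring_type R).
Proof. by split=> x y; rewrite ?mul1r ?mulr1. Qed.

Lemma regularM (r s : subring_type R) :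
  regular r -> regular s -> regular (r * s).
Proof. by move=> [lr rr] [ls rs]; split; [exact: GRing.lregM|exact: GRing.rregM]. Qed.

Lemma fractional1 : fractional [set` R].
Proof.
split.
- split=> /= [|x y|r x|r x]; first exact: rpred0.
  + exact: rpredB.
  + exact: rpredM.
  + by move=> Rr Rx; exact: rpredM.
- by exists 1; [exact: regular1|exact: valP].
- by exists 1; [exact: regular1|move=> x Rx; rewrite mul1r].
Qed.

Lemma fractionalM I J :
  fractional I -> fractional J -> fractional (prod_set I J).
Proof.
move=> [[I0 IB Il Ir] [r regr Ir0] [r' regr' Ir']].
move=> [[J0 JB Jl Jr] [s regs Js0] [s' regs' Js']].
have IN x : I x -> I (- x) by rewrite -sub0r; exact: IB.
split; first split.
- by exists 0%N, (fun=> 0), (fun=> 0); split=> //; rewrite big_ord0.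
- move=> _ _ [n [x [y [Ix Jy ->]]]] [m [x' [y' [Ix' Jy' ->]]]].
  exists (n + m)%N.
  exists (fun i => match split i with inl j => x j | inr j => - x' j end).
  exists (fun i => match split i with inl j => y j | inr j => y' j end).
  split=> [i|i|]; [by case: split; auto|by case: split; auto|].
  rewrite big_split_ord -sumrN /=; congr (_ + _); apply: eq_bigr => i _.
    by rewrite -[lshift _ _]/(unsplit (inl i)) unsplitK.
  by rewrite -[rshift _ _]/(unsplit (inr i)) unsplitK mulNr.
- move=> c _ Rc [n [x [y [Ix Jy ->]]]]; exists n, (fun i => c * x i), y.
  by split; auto; rewrite mulr_sumr; apply: eq_bigr => i _; rewrite mulrA.
- move=> c _ Rc [n [x [y [Ix Jy ->]]]]; exists n, x, (fun i => y i * c).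
  by split; auto; rewrite mulr_suml; apply: eq_bigr => i _; rewrite mulrA.
- exists (r * s); first exact: regularM.
  by exists 1%N, (fun=> val r), (fun=> val s); split=> //; rewrite big_ord1.
- exists (s' * r'); first exact: regularM.
  move=> _ [n [x [y [Ix Jy ->]]]]; rewrite mulr_sumr rpred_sum // => i _.
  rewrite rmorphM -mulrA [val r' * _]mulrA.
  by apply: Js'; apply: Jl => //; exact: Ir'.
Qed.

Definition frac_one : frac_ideal := FracIdeal fractional1.

Definition frac_mul (I J : frac_ideal) : frac_ideal :=
  FracIdeal (fractionalM (fracP I) (fracP J)).

Definition left_colon (X I : set A) : set A :=
  [set a | forall x, I x -> X (a * x)].

Definition value_group : set (set A) :=
  [set g | exists I : frac_ideal, g = left_colon P I].

Fact value_subproof (I : frac_ideal) : left_colon P I \in value_group.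
Proof. by apply/mem_set; exists I. Qed.

Definition value (I : frac_ideal) : value_group :=
  exist _ (left_colon P I) (value_subproof I).

Definition value_le (g h : value_group) : Prop := val g `<=` val h.

Definition value_lt (g h : value_group) : Prop := value_le g h /\ g <> h.

(* The values of the principal bimodules [RaR], where [a = 0] satisfies every
   lower bound by convention ([R 0 R] is never fractional). *)
Definition value_gen_gt a (g : value_group) : Prop :=
  a = 0 \/ exists I : frac_ideal,
    frac_carrier I = bimodule_gen a /\ value_lt g (value I).

Definition value_gen_ge a (g : value_group) : Prop :=
  a = 0 \/ exists I : frac_ideal,
    frac_carrier I = bimodule_gen a /\ value_le g (value I).

End FractionalIdeals.

Section OrderedStructures.
Variables (G : Type) (le : G -> G -> Prop) (add : G -> G -> G) (zero : G).

Definition partial_order : Prop :=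
  [/\ forall x, le x x, forall x y, le x y -> le y x -> x = y
    & forall x y z, le x y -> le y z -> le x z].

(* Additive notation is used without commutativity; the neutral element is
   required because pseudo-valuations take the value [0] on [R]. *)
Definition partially_ordered_semigroup : Prop :=
  [/\ partial_order, associative add, left_id zero add /\ right_id zero add
    & forall x y z, le x y -> le (add x z) (add y z) /\ le (add z x) (add z y)].

Definition totally_ordered_group : Prop :=
  [/\ partially_ordered_semigroup, forall x y, le x y \/ le y x
    & forall x, exists y, add x y = zero /\ add y x = zero].

(* In a partially ordered [G], [k >= min(g, h)] is read as: [k] is above every
   common lower bound of [g] and [h]; it is the usual meaning whenever the
   minimum exists, in particular when [le] is total. The same clause asserts
   that [I + J] is fractional, so that its value is defined. *)
Definition arithmetical_pseudo_valuation (A : nzRingType)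
    (R : subringClosed A) (v : frac_ideal R -> G) : Prop :=
  partially_ordered_semigroup /\
  [/\ forall I J : frac_ideal R, v (frac_mul I J) = add (v I) (v J),
      forall I J : frac_ideal R, exists2 K : frac_ideal R,
        frac_carrier K = sum_set I J &
        forall g, le g (v I) -> le g (v J) -> le g (v K),
      v (frac_one R) = zero
    & forall I J : frac_ideal R, frac_carrier I `<=` frac_carrier J -> le (v J) (v I)].

End OrderedStructures.

(* Main.v *)
Require Import Defs.
From HB Require Import structures.
From mathcomp Require Import all_boot all_order all_algebra.
From mathcomp Require Import generic_quotient boolp classical_sets.

Set Implicit Arguments.
Unset Strict Implicit.
Unset Printing Implicit Defensive.

Import GRing.Theory.
Local Open Scope classical_set_scope.
Local Open Scope ring_scope.

(* A bimodule not contained in [P] contains [1], so bimodules are comparable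
   with [R]. If [R <> A], some [a] outside [R] satisfies [Pa <= R], while
   [Pa <= P] would force [a] into [R]; hence [P] is invertible. Noetherian
   induction with Nakayama's lemma then makes every nonzero ideal of [R]
   invertible, and the chain conditions yield denominators and regular elements,
   so that [RaR] is fractional for [a <> 0]. Consequently fractional ideals form
   a group, are totally ordered by inclusion, and [I] is recovered from [(P : I)]
   as the set of [x] with [(P : I)x <= P]. *)

(** * Chain conditions, maximal left ideals and quasi-regularity *)

Section ChainConditions.
Variable T : pzRingType.
Implicit Types (C F : set T -> Prop) (M N : set T).

(** Without a minimal member, repeatedly choosing a strictly smaller one from [M0] on gives a
    descending sequence that never stabilizes. *)
Lemma dcc_minimal C F M0 : dcc C -> (forall M, F M -> C M) -> F M0 ->
  exists2 M, F M & forall N, F N -> N `<=` M -> N = M.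
Proof.
move=> dccC FC FM0; apply: contrapT => noMin.
have step M : exists N, F M -> [/\ F N, N `<=` M & N <> M].
  have [FM|] := pselect (F M); last by exists M.
  apply: contrapT => noN; apply: noMin; exists M => // N FN NM.
  by apply: contrapT => neNM; apply: noN; exists N.
have [f fP] := choice step.
have Fu n : F (iter n f M0) by elim: n => //= n /fP[].
have [|n|N /(_ N.+1 (leqnSn _))] := dccC (fun n => iter n f M0).
- by move=> n; apply: FC.
- by have [] := fP _ (Fu n).
- by have [] := fP _ (Fu N).
Qed.

Lemma acc_maximal C F M0 : acc C -> (forall M, F M -> C M) -> F M0 ->
  exists2 M, F M & forall N, F N -> M `<=` N -> N = M.
Proof.
move=> accC FC FM0; apply: contrapT => noMax.
have step M : exists N, F M -> [/\ F N, M `<=` N & N <> M].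
  have [FM|] := pselect (F M); last by exists M.
  apply: contrapT => noN; apply: noMax; exists M => // N FN MN.
  by apply: contrapT => neNM; apply: noN; exists N.
have [f fP] := choice step.
have Fu n : F (iter n f M0) by elim: n => //= n /fP[].
have [|n|N /(_ N.+1 (leqnSn _))] := accC (fun n => iter n f M0).
- by move=> n; apply: FC.
- by have [] := fP _ (Fu n).
- by have [] := fP _ (Fu N).
Qed.

(* The least essential left ideal exists by the descending chain condition, and
   it is two-sided because the preimage of an essential left ideal under a right
   multiplication is essential. *)
Lemma essential_left_ideal_full (L : set T) :
    simple_ring T -> dcc (@left_ideal T) -> left_ideal L ->
    (forall x, x <> 0 -> exists2 r, L (r * x) & r * x <> 0) -> L 1.
Proof.
move=> [T1 simT] dccT idL essL.
pose ess M := left_ideal M /\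
  forall x : T, x <> 0 -> exists2 r, M (r * x) & r * x <> 0.
have [E [idE essE] minE] : exists2 M, ess M & forall N, ess N -> N `<=` M -> N = M.
  by apply: (dcc_minimal (F := ess) (M0 := L) dccT) => // M [].
have leE M : ess M -> E `<=` M.
  move=> [[M0 MB MM] essM].
  have [E0 EB EM] := idE.
  rewrite -(minE (E `&` M)); [by move=> x []| |by move=> x []].
  split; first split.
  - by [].
  - by move=> x y [? ?] [? ?]; split; auto.
  - by move=> r x [? ?]; split; auto.
  - move=> x /essE[r Er rx0]; have [s Ms sx0] := essM _ rx0.
    by exists (s * r); rewrite -mulrA //; split => //; exact: EM.
have ridE : right_ideal E.
  have [E0 EB EM] := idE; split=> // a x Ex.
  suff /leE : ess [set x | E (x * a)] by apply.
  split; first split=> /=.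
  - by rewrite mul0r.
  - by move=> y z Ey Ez; rewrite mulrBl; exact: EB.
  - by move=> r y Ey; rewrite -mulrA; exact: EM.
  - move=> y y0; have [ya0|ya0] := pselect (y * a = 0).
      by exists 1; rewrite /= mul1r // ya0.
    have [r Er ry] := essE _ ya0; exists r; rewrite /= -?mulrA //.
    by move=> ry0; apply: ry; rewrite mulrA ry0 mul0r.
have [E0|ET] := simT _ idE ridE.
  by have [r] := essE _ T1; rewrite E0.
by apply: (leE L); rewrite ?ET.
Qed.

(** The ascending chain condition stands in for Zorn's lemma. *)
Lemma maximal_left_ideal_exists (L : set T) :
    acc (@left_ideal T) -> left_ideal L -> ~ L 1 ->
  exists2 M, maximal_left_ideal M & L `<=` M.
Proof.
move=> accT idL nL1.
pose F M := [/\ left_ideal M, ~ M 1 & L `<=` M].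
have [M [idM nM1 LM] maxM] : exists2 M, F M & forall N, F N -> M `<=` N -> N = M.
  by apply: (acc_maximal (F := F) (M0 := L) accT) => [M []|] //; split.
exists M => //; split=> //; first by move=> MT; apply: nM1; rewrite MT.
move=> I idI MI; have [I1|nI1] := pselect (I 1).
  right; rewrite -subTset => x _; have [_ _ IM] := idI.
  by rewrite -(mulr1 x); exact: IM.
by left; apply: maxM => //; split=> // x /LM /MI.
Qed.

(** Otherwise the proper left ideal generated by [1 - p] lies in a maximal left ideal, which
    contains [p] too, hence [1]. *)
Lemma jacobson_left_inverse (p : T) :
  acc (@left_ideal T) -> jacobson p -> exists u, u * (1 - p) = 1.
Proof.
move=> accT Jp; apply: contrapT => nu.
have [||M maxM sM] := @maximal_left_ideal_exists [set x | exists u, x = u * (1 - p)] accT.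
- split=> /=; first by exists 0; rewrite mul0r.
  + by move=> _ _ [u ->] [w ->]; exists (u - w); rewrite mulrBl.
  + by move=> r _ [u ->]; exists (r * u); rewrite mulrA.
- by move=> [u e]; apply: nu; exists u.
have [[M0 MB MM] nMT _] := maxM; apply: nMT; rewrite -subTset => x _.
rewrite -(mulr1 x); apply: (MM).
have -> : 1 = (1 - p) - (0 - p) by rewrite sub0r opprK subrK.
apply: (MB); first by apply: sM; exists 1; rewrite mul1r.
by apply: (MB) => //; exact: Jp.
Qed.

End ChainConditions.

(** * One-sided inverses under the descending chain condition *)

Section ArtinianUnits.
Variable T : pzRingType.
Hypothesis dccT : dcc (@left_ideal T).

Lemma left_ideal_principal (x : T) : left_ideal [set y | exists u, y = u * x].
Proof.
split=> /=; first by exists 0; rewrite mul0r.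
- by move=> _ _ [u ->] [w ->]; exists (u - w); rewrite mulrBl.
- by move=> r _ [u ->]; exists (r * u); rewrite mulrA.
Qed.

Lemma dcc_pow (x : T) : exists n y, x ^+ n = y * x ^+ n.+1.
Proof.
have [|n|N HN] := dccT (u := fun n => [set y | exists u, y = u * x ^+ n]).
- by move=> n; exact: left_ideal_principal.
- by move=> _ /= [u ->]; exists (u * x); rewrite exprS mulrA.
have : [set y | exists u, y = u * x ^+ N] (x ^+ N) by exists 1; rewrite mul1r.
by rewrite -(HN N.+1 (leqnSn _)) => -[y e]; exists N, y.
Qed.

(** In [x ^+ n = y * x ^+ n.+1], cancelling [x ^+ n] on the right gives [y * x = 1]; then
    [x * y - 1] annihilates [x] from the left, so it vanishes. *)
Lemma dcc_left_cancel (x : T) : (forall a, a * x = 0 -> a = 0) ->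
  exists2 y, y * x = 1 & x * y = 1.
Proof.
move=> x0; have x0n n a : a * x ^+ n = 0 -> a = 0.
  elim: n a => [a|n IHn a]; first by rewrite mulr1.
  by rewrite exprSr mulrA => /x0 /IHn.
have [n [y e]] := dcc_pow x; exists y.
  apply/esym/subr0_eq/(x0n n).
  by rewrite mulrBl mul1r -mulrA -exprS -e subrr.
apply/esym/subr0_eq/x0; rewrite mulrBl mul1r -mulrA.
suff -> : y * x = 1 by rewrite mulr1 subrr.
by apply/esym/subr0_eq/(x0n n); rewrite mulrBl mul1r -mulrA -exprS -e subrr.
Qed.

(** Dedekind finiteness: multiplying [y ^+ n = z * y ^+ n.+1] by [x ^+ n] on the right gives
    [z * y = 1], so [z = x] and [x * y = 1]. *)
Lemma dcc_left_inverse (x y : T) : y * x = 1 -> forall a, a * x = 0 -> a = 0.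
Proof.
move=> yx1; have [n [z e]] := dcc_pow y.
have yxn k : y ^+ k * x ^+ k = 1.
  elim: k => [|k IHk]; first by rewrite mulr1.
  by rewrite exprSr exprS mulrA -[_ * y * x]mulrA yx1 mulr1.
have zy1 : z * y = 1.
  by rewrite -[LHS]mulr1 -(yxn n) mulrA -[z * y * _]mulrA -exprS -e yxn.
have zx : z = x by rewrite -[LHS]mulr1 -yx1 mulrA zy1 mul1r.
by move=> a ax0; rewrite -[a]mulr1 -zy1 zx mulrA ax0 mul0r.
Qed.

End ArtinianUnits.

(** * Ideals modulo the Jacobson radical *)

Section RadicalQuotient.
Variable T : pzRingType.
Local Notation pi := (\pi_(jquot T))%qT.

Lemma jquot_pi0 : pi 0 = 0.
Proof. by apply: (addIr (pi 0)); rewrite jquot_piD !add0r. Qed.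

Lemma jquot_pi_eq0 (x : T) : pi x = 0 <-> jacobson x.
Proof. by rewrite -jquot_pi0 jquot_eqP subr0. Qed.

Lemma jquot_piB (x y : T) : pi (x - y) = pi x - pi y.
Proof. by apply: (addIr (pi y)); rewrite jquot_piD !subrK. Qed.

Lemma jquot_piM (x y : T) : pi (x * y) = pi x * pi y.
Proof. by rewrite -jquot_pi_mul. Qed.

Lemma left_ideal_pi (L : set T) : left_ideal L -> left_ideal (pi @` L).
Proof.
move=> [L0 LB LM]; split.
- by exists 0 => //; exact: jquot_pi0.
- move=> _ _ [x Lx <-] [y Ly <-]; exists (x - y); first exact: LB.
  exact: jquot_piB.
- move=> r _ [x Lx <-]; elim/quotW: r => r.
  by exists (r * x); [exact: LM|exact: jquot_piM].
Qed.

Lemma right_ideal_pi (L : set T) : right_ideal L -> right_ideal (pi @` L).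
Proof.
move=> [L0 LB LM]; split.
- by exists 0 => //; exact: jquot_pi0.
- move=> _ _ [x Lx <-] [y Ly <-]; exists (x - y); first exact: LB.
  exact: jquot_piB.
- move=> r _ [x Lx <-]; elim/quotW: r => r.
  by exists (x * r); [exact: LM|exact: jquot_piM].
Qed.

(** An element congruent to [1] modulo the radical is left invertible. This carries conclusions
    about the simple Artinian quotient back to the ring. *)
Lemma left_ideal_pi1 (L : set T) : acc (@left_ideal T) -> left_ideal L ->
  (pi @` L) 1 -> L 1.
Proof.
move=> accT [_ _ LM] [x Lx /jquot_eqP Jx].
have J1x : jacobson (1 - x).
  rewrite -opprB -sub0r; apply: jacobsonB => //.
  by move=> M [[]].
have [u] := jacobson_left_inverse accT J1x.
by rewrite opprB addrC subrK => <-; exact: LM.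
Qed.

End RadicalQuotient.

(** * Products of bimodules and principal bimodules *)

Section Products.
Variable A : nzRingType.
Implicit Types I J K : set A.

Lemma prod_setM I J x y : I x -> J y -> prod_set I J (x * y).
Proof.
by move=> Ix Jy; exists 1%N, (fun=> x), (fun=> y); split=> //; rewrite big_ord1.
Qed.

Lemma prod_set0 I J : prod_set I J 0.
Proof.
exists 0%N, (fun=> 0), (fun=> 0); rewrite big_ord0.
by split=> // -[].
Qed.

Lemma prod_setD I J x y :
  prod_set I J x -> prod_set I J y -> prod_set I J (x + y).
Proof.
move=> [n [a [b [Ia Jb ->]]]] [m [c [d [Ic Jd ->]]]]; exists (n + m)%N.
exists (fun i => match split i with inl j => a j | inr j => c j end).
exists (fun i => match split i with inl j => b j | inr j => d j end).
split=> [i|i|]; try by case: split.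
rewrite big_split_ord /=; congr (_ + _); apply: eq_bigr => i _.
  by rewrite -[lshift _ _]/(unsplit (inl i)) unsplitK.
by rewrite -[rshift _ _]/(unsplit (inr i)) unsplitK.
Qed.

(** [prod_set I J] is the least additive submonoid containing the products; applied to preimages
    [K], this replaces computations with finite sums. *)
Lemma prod_set_sub I J K : K 0 -> (forall x y, K x -> K y -> K (x + y)) ->
  (forall x y, I x -> J y -> K (x * y)) -> prod_set I J `<=` K.
Proof.
move=> K0 KD KM _ [n [x [y [Ix Jy ->]]]].
by apply: (big_ind K) => // i _; exact: KM.
Qed.

Lemma prod_setS I J I' J' :
  I `<=` I' -> J `<=` J' -> prod_set I J `<=` prod_set I' J'.
Proof.
move=> sI sJ; apply: prod_set_sub; [exact: prod_set0|exact: prod_setD|].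
by move=> x y /sI Ix /sJ Jy; exact: prod_setM.
Qed.

Lemma prod_setA I J K :
  prod_set I (prod_set J K) = prod_set (prod_set I J) K.
Proof.
rewrite eqEsubset; split.
  apply: prod_set_sub; [exact: prod_set0|exact: prod_setD|].
  move=> x y Ix; suff : prod_set J K `<=` [set y | prod_set (prod_set I J) K (x * y)] by apply.
  apply: prod_set_sub => [|a b|a b Ja Kb] /=.
  - by rewrite mulr0; exact: prod_set0.
  - by rewrite mulrDr; exact: prod_setD.
  - by rewrite mulrA; apply: prod_setM => //; exact: prod_setM.
apply: prod_set_sub; [exact: prod_set0|exact: prod_setD|].
move=> x y + Ky; move: x.
suff : prod_set I J `<=` [set x | prod_set I (prod_set J K) (x * y)] by [].
apply: prod_set_sub => [|a b|a b Ja Kb] /=.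
- by rewrite mul0r; exact: prod_set0.
- by rewrite mulrDl; exact: prod_setD.
- by rewrite -mulrA; apply: prod_setM => //; exact: prod_setM.
Qed.

Variable R : subringClosed A.

Lemma bimoduleD I x y : bimodule R I -> I x -> I y -> I (x + y).
Proof.
move=> [I0 IB _ _] Ix Iy; rewrite -[y]opprK; apply: (IB) => //.
by rewrite -sub0r; exact: IB.
Qed.

Lemma bimodule_subring : bimodule R [set` R].
Proof.
split=> /= [|x y|r x|r x]; [exact: rpred0|exact: rpredB|exact: rpredM|].
by move=> ? ?; exact: rpredM.
Qed.

Lemma bimoduleM I J : bimodule R I -> bimodule R J -> bimodule R (prod_set I J).
Proof.
move=> [I0 IB Il Ir] [J0 JB Jl Jr]; split; first exact: prod_set0.
- move=> x y Ix Iy; apply: prod_setD => //; move: y Iy.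
  suff : prod_set I J `<=` [set y | prod_set I J (- y)] by [].
  apply: prod_set_sub => [|a b|a b Ia Jb] /=.
  + by rewrite oppr0; exact: prod_set0.
  + by rewrite opprD; exact: prod_setD.
  + by rewrite -mulNr; apply: prod_setM => //; rewrite -sub0r; exact: IB.
- move=> r x Rr; move: x.
  suff : prod_set I J `<=` [set y | prod_set I J (r * y)] by [].
  apply: prod_set_sub => [|a b|a b Ia Jb] /=.
  + by rewrite mulr0; exact: prod_set0.
  + by rewrite mulrDr; exact: prod_setD.
  + by rewrite mulrA; apply: prod_setM => //; exact: Il.
- move=> r x Rr; move: x.
  suff : prod_set I J `<=` [set y | prod_set I J (y * r)] by [].
  apply: prod_set_sub => [|a b|a b Ia Jb] /=.
  + by rewrite mul0r; exact: prod_set0.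
  + by rewrite mulrDl; exact: prod_setD.
  + by rewrite -mulrA; apply: prod_setM => //; exact: Jr.
Qed.

Lemma prod_subring_set I : bimodule R I -> prod_set [set` R] I = I.
Proof.
move=> bI; have [I0 _ Il _] := bI; rewrite eqEsubset; split.
  by apply: prod_set_sub => // x y; exact: bimoduleD.
by move=> x Ix; rewrite -[x]mul1r; apply: prod_setM => //=; exact: rpred1.
Qed.

Lemma prod_set_subring I : bimodule R I -> prod_set I [set` R] = I.
Proof.
move=> bI; have [I0 _ _ Ir] := bI; rewrite eqEsubset; split.
  by apply: prod_set_sub => [|x y|x y Ix Ry]; [by []|exact: bimoduleD|exact: Ir].
by move=> x Ix; rewrite -[x]mulr1; apply: prod_setM => //=; exact: rpred1.
Qed.

Lemma bimodule_genP a : bimodule R (bimodule_gen R a).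
Proof.
split.
- by exists 0%N, (fun=> 0), (fun=> 0); rewrite big_ord0.
- move=> _ _ [n [r [s ->]]] [m [r' [s' ->]]]; exists (n + m)%N.
  exists (fun i => match split i with inl j => r j | inr j => - r' j end).
  exists (fun i => match split i with inl j => s j | inr j => s' j end).
  rewrite big_split_ord -sumrN /=; congr (_ + _); apply: eq_bigr => i _.
    by rewrite -[lshift _ _]/(unsplit (inl i)) unsplitK.
  by rewrite -[rshift _ _]/(unsplit (inr i)) unsplitK -!mulNr.
- move=> c _ Rc [n [r [s ->]]].
  exists n, (fun i => SubringType Rc * r i), s.
  by rewrite mulr_sumr; apply: eq_bigr => i _; rewrite rmorphM !mulrA.
- move=> c _ Rc [n [r [s ->]]].
  exists n, r, (fun i => s i * SubringType Rc).
  by rewrite mulr_suml; apply: eq_bigr => i _; rewrite rmorphM !mulrA.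
Qed.

Lemma mem_bimodule_gen a : bimodule_gen R a a.
Proof.
by exists 1%N, (fun=> 1), (fun=> 1); rewrite big_ord1 rmorph1 mul1r mulr1.
Qed.

Lemma bimodule_gen_sub a I : bimodule R I -> I a -> bimodule_gen R a `<=` I.
Proof.
move=> bI Ia _ [n [r [s ->]]]; have [I0 _ Il Ir] := bI.
apply: (big_ind I) => // [x y|i _]; first exact: bimoduleD.
by apply: Ir; [exact: valP|apply: Il => //; exact: valP].
Qed.

End Products.

(** * Bimodules over a Noetherian Dubrovin valuation ring *)

Section Dubrovin.
Variables (A : nzRingType) (R : subringClosed A).
Hypotheses (hA : simple_artinian A) (hR : dubrovin_valuation_ring R)
  (hN : noetherian (subring_type R)).
Local Notation S := (subring_type R).
Local Notation P := (radical R).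
Local Notation O := [set` R].
Local Notation "I ** J" := (prod_set I J) (at level 40, left associativity).
Local Notation pi := (\pi_(jquot S))%qT.
Implicit Types (I J Z : set A) (x y q a : A).

Lemma radical_sub : P `<=` O.
Proof. by move=> _ [y _ <-]; exact: valP. Qed.

Lemma bimodule_radical : bimodule R P.
Proof.
split.
- by exists 0 => // M [[]].
- move=> _ _ [x Jx <-] [y Jy <-]; exists (x - y); first exact: jacobsonB.
  exact: rmorphB.
- move=> r _ Rr [x Jx <-]; exists (SubringType Rr * x); first exact: jacobsonMl.
  exact: rmorphM.
- move=> r _ Rr [x Jx <-]; exists (x * SubringType Rr); first exact: jacobsonMr.
  exact: rmorphM.
Qed.

Lemma radical_inverse p : P p -> exists2 u, u \in R & u * (1 - p) = 1.
Proof.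
move=> [x Jx <-]; have [u u1] := jacobson_left_inverse hN.1 Jx.
exists (val u); first exact: valP.
by have := congr1 val u1; rewrite rmorphM rmorphB rmorph1.
Qed.

Lemma radical_not1 : ~ P 1.
Proof.
move=> /radical_inverse[u _ /eqP].
by rewrite subrr mulr0 eq_sym oner_eq0.
Qed.

Lemma left_quotient q : q \notin R ->
  exists2 r, r \in R & r * q \in R /\ ~ P (r * q).
Proof. by move=> /(hR.2 _)[r [_ [Rr _ ? _]]]; exists r. Qed.

Lemma right_quotient q : q \notin R ->
  exists2 r, r \in R & q * r \in R /\ ~ P (q * r).
Proof. by move=> /(hR.2 _)[_ [r [_ Rr _ ?]]]; exists r. Qed.

(** The Dubrovin condition moves an element of [I] outside [P] into [R], still outside [P]. So the
    ideal [L] of elements of [R] lying in [I] has nonzero, hence full, image in the simple quotient,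
    and [1] lifts. *)
Lemma bimodule_one I : bimodule R I -> ~ (I `<=` P) -> I 1.
Proof.
move=> [I0 IB Il Ir] /existsNP[q /not_implyP[Iq nPq]].
have [x [Ix Rx nPx]] : exists x, [/\ I x, x \in R & ~ P x].
  have [Rq|nRq] := boolP (q \in R); first by exists q.
  by have [r Rr [Rrq nPrq]] := left_quotient nRq; exists (r * q); split; auto.
pose L := [set r : S | I (val r)].
have lL : left_ideal L.
  split; first by rewrite /L.
    by move=> a b La Lb; rewrite /L /=; exact: IB.
  by move=> a b Lb; rewrite /L /=; apply: Il => //; exact: valP.
have rL : right_ideal L.
  split; first by rewrite /L.
    by move=> a b La Lb; rewrite /L /=; exact: IB.
  by move=> a b Lb; rewrite /L /=; apply: Ir => //; exact: valP.
have [E|E] := hR.1.1.2 _ (left_ideal_pi lL) (right_ideal_pi rL).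
  have : (pi @` L) (pi (SubringType Rx)) by exists (SubringType Rx).
  rewrite E => /jquot_pi_eq0 Jx; case: nPx.
  by exists (SubringType Rx).
suff : L 1 by rewrite /L.
by apply: left_ideal_pi1 => //; [exact: hN.1|rewrite E].
Qed.

Lemma subring_sub_bimodule I : bimodule R I -> I 1 -> O `<=` I.
Proof. by move=> [_ _ Il _] I1 x Rx; rewrite -[x]mulr1; exact: Il. Qed.

Lemma bimodule_comparable I : bimodule R I -> I `<=` O \/ O `<=` I.
Proof.
move=> bI; have [IP|nIP] := pselect (I `<=` P).
  by left=> x /IP; exact: radical_sub.
by right; apply: subring_sub_bimodule => //; exact: bimodule_one.
Qed.

(* [{r in R | rq in R}] is essential modulo [P], hence contains [1]. *)
Lemma radical_right_order q : (forall p, P p -> P (p * q)) -> q \in R.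
Proof.
move=> Pq; pose L := [set r : S | val r * q \in R].
have lL : left_ideal L.
  split; first by rewrite /L /= mul0r rpred0.
    by move=> a b La Lb; rewrite /L /= mulrBl; exact: rpredB.
  move=> a b Lb; rewrite /L /= -mulrA; apply: rpredM => //; exact: valP.
suff : L 1 by rewrite /L /= mul1r.
apply: left_ideal_pi1 => //; first exact: hN.1.
apply: (essential_left_ideal_full hR.1.1 hR.1.2.1 (left_ideal_pi lL)).
elim/quotW=> x /jquot_pi_eq0 nJx.
have [Rxq|nRxq] := boolP (val x * q \in R).
  exists 1; rewrite mul1r; last by move/jquot_pi_eq0.
  by exists x.
have [r Rr [Rrxq nPrxq]] := left_quotient nRxq.
exists (pi (SubringType Rr)).
  exists (SubringType Rr * x); last exact: jquot_piM.
  by rewrite /L /= -mulrA.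
(* If [r * x] were in [P], the assumption on [q] would put [r * x * q] in [P] too. *)
rewrite -jquot_piM => /jquot_pi_eq0 Jrx; apply: nPrxq.
by rewrite mulrA; apply: Pq; exists (SubringType Rr * x).
Qed.

(** Chain conditions concern subsets of [S], while the families used below consist of subsets of
    [A]; a subset of [R] is determined by its preimage in [S]. *)
Lemma acc_subring_maximal (C : set S -> Prop) (F : set A -> Prop) M0 :
    acc C -> (forall M, F M -> C (val @^-1` M) /\ M `<=` O) -> F M0 ->
  exists2 M, F M & forall N, F N -> M `<=` N -> N = M.
Proof.
move=> accC FC FM0.
pose G (N : set S) := exists2 M, F M & N = val @^-1` M.
have [|| _ [M FM ->] maxM] := acc_maximal (F := G) (M0 := val @^-1` M0) accC.
- by move=> _ [M /FC[CM _] ->].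
- by exists M0.
exists M => // N FN MN.
have E : val @^-1` N = val @^-1` M :> set S.
  by apply: maxM => [|x]; [exists N|exact: MN].
rewrite eqEsubset; split=> // x Nx; have [_ /(_ _ Nx) Rx] := FC _ FN.
have : (val @^-1` N) (SubringType Rx) by [].
by rewrite E.
Qed.

(** * Invertible bimodules, invertibility of the radical, Nakayama's lemma *)

(** The inverse is only asked to be a bimodule; for fractional [I] it is shown to be fractional in
    [fractional_inverse]. *)
Definition invertible I :=
  exists Z, [/\ bimodule R Z, I ** Z = O & Z ** I = O].

Lemma invertible_subring : invertible O.
Proof.
by exists O; rewrite (prod_subring_set (bimodule_subring R)); split=> //;
  exact: bimodule_subring.
Qed.

Lemma invertibleM I J : bimodule R I -> bimodule R J ->
  invertible I -> invertible J -> invertible (I ** J).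
Proof.
move=> bI bJ [Z [bZ IZ ZI]] [W [bW JW WJ]]; exists (W ** Z); split.
- exact: bimoduleM.
- by rewrite prod_setA -(prod_setA I) JW prod_set_subring.
- by rewrite prod_setA -(prod_setA W) ZI prod_set_subring.
Qed.

(* For [a] outside [R] with [{r in R | ar in R}] maximal, [pa] outside [R]
   would have the same denominators as [a], and [par] would lie in [P]
   whenever it lies in [R]. *)
Lemma radical_denominator : (exists q, q \notin R) ->
  exists2 a, a \notin R & forall p, P p -> p * a \in R.
Proof.
move=> [q nRq]; pose W a := [set r | r \in R /\ a * r \in R].
pose F M := exists2 a, a \notin R & M = W a.
have [|| _ [a nRa ->] maxa] := acc_subring_maximal (F := F) (M0 := W q) hN.2.
- move=> _ [a nRa ->]; split; last by move=> x [].
  split; rewrite /preimage /W /=.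
  + by rewrite /= mulr0 rpred0.
  + by move=> x y [Rx ?] [Ry ?]; rewrite /= mulrBr; split; exact: rpredB.
  + move=> r x [Rx Rax]; rewrite /= mulrA.
    by split; apply: rpredM => //; exact: valP.
- by exists q.
exists a => // p Pp; apply: contrapT => /negP nRpa.
have Wpa : W (p * a) = W a.
  apply: maxa; first by exists (p * a).
  move=> r [Rr Rar]; split=> //; rewrite -mulrA; apply: rpredM => //.
  exact: radical_sub.
have [r Rr [Rpar nPpar]] := right_quotient nRpa; apply: nPpar.
have : W (p * a) r by [].
rewrite Wpa => -[_ Rar]; rewrite -mulrA.
by have [_ _ _ Pr] := bimodule_radical; exact: Pr.
Qed.

(** The inverse is the largest [Y] with [PY <= R]. If [PY <= P], the element [a] outside [R] with
    [Pa <= R] would satisfy [Pa <= P], hence lie in [R]. *)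
Lemma radical_invertible : (exists q, q \notin R) -> invertible P.
Proof.
move=> /radical_denominator[a nRa PaR]; have bP := bimodule_radical.
pose Y := [set y | forall p, P p -> p * y \in R].
have bY : bimodule R Y.
  split=> [p Pp|x y Yx Yy p Pp|r x Rr Yx p Pp|r x Rr Yx p Pp].
  - by rewrite mulr0 rpred0.
  - by rewrite mulrBr; apply: rpredB; auto.
  - by rewrite mulrA; apply: Yx; have [_ _ _ Pr] := bP; exact: Pr.
  - by rewrite mulrA; apply: rpredM => //; exact: Yx.
have bPY := bimoduleM bP bY; have bYP := bimoduleM bY bP.
have PY : P ** Y = O.
  rewrite eqEsubset; split.
    apply: prod_set_sub => [|x y|p y Pp Yy] /=; first exact: rpred0.
      exact: rpredD.
    exact: Yy.
  apply: subring_sub_bimodule => //; apply: bimodule_one => // sPYP.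
  case/negP: nRa; apply: radical_right_order => p Pp.
  by apply: sPYP; exact: prod_setM.
(* Since [P(YP) = P], right multiplication by an element of [YP] preserves [P], so
   [radical_right_order] gives [YP <= R]. *)
exists Y; split=> //; rewrite eqEsubset; split.
  move=> x YPx; apply: radical_right_order => p Pp.
  rewrite -[P](prod_subring_set bP) -PY -prod_setA.
  exact: prod_setM.
apply: subring_sub_bimodule => //; apply: bimodule_one => // sYPP.
apply: radical_not1.
have : O 1 by exact: rpred1.
rewrite -PY => P1.
(* Under [YP <= P] one gets [P = PYP <= PP], whence [R = PY <= PPY = P]. *)
have sPPP : P `<=` P ** P.
  rewrite -[X in X `<=` _](prod_subring_set bP) -PY -prod_setA.
  exact: prod_setS.
suff sPYP : P ** Y `<=` P by exact: sPYP.
rewrite -[X in _ `<=` X](prod_set_subring bP) -PY prod_setA.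
exact: prod_setS.
Qed.

(** For [M] a maximal proper left submodule of [I], the quotient [I/M] is simple, so any [s] in [I]
    outside [M] has a maximal left ideal as annihilator modulo [M]. That ideal contains [P], so
    [PI <= M]. *)
Lemma nakayama I : bimodule R I -> I `<=` O -> I `<=` P ** I -> I `<=` [set 0].
Proof.
move=> bI IO IPI; have [I0 IB Il _] := bI; apply: contrapT => nI0.
pose F M := [/\ [/\ M 0, forall x y, M x -> M y -> M (x - y)
  & forall r x, r \in R -> M x -> M (r * x)], M `<=` I & M <> I].
have FC M : F M -> left_ideal (val @^-1` M : set S) /\ M `<=` O.
  move=> [[M0 MB MM] MI _]; split; last by move=> x /MI /IO.
  split; rewrite /preimage /=.
  - by [].
  - by move=> x y ? ?; exact: MB.
  - by move=> r x ?; rewrite /=; apply: MM => //; exact: valP.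
have [|M FM maxM] := acc_subring_maximal (M0 := [set 0]) hN.1 FC.
  split; last 2 first.
  - by move=> _ ->.
  - by move=> E; apply: nI0; rewrite -E.
  split=> //=; first by move=> x y -> ->; rewrite subr0.
  by move=> r x _ ->; rewrite mulr0.
have [[M0 MB MM] MI nMI] := FM; apply: nMI; rewrite eqEsubset; split=> // x /IPI.
have MD y z : M y -> M z -> M (y + z).
  by move=> My Mz; rewrite -[z]opprK -[- z]sub0r; apply: (MB) => //; exact: MB.
move: x; apply: prod_set_sub => // _ s [p Jp <-] Is.
apply: contrapT => nMps.
have nMs : ~ M s by move=> Ms; apply: nMps; apply: MM => //; exact: valP.
apply: nMps; apply: (Jp [set r : S | M (val r * s)]); split.
- split=> /=; first by rewrite /= mul0r.
  + by move=> a b ? ?; rewrite /= mulrBl; exact: MB.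
  + by move=> r a ?; rewrite /= -mulrA; apply: MM => //; exact: valP.
- move=> E; apply: nMs; have : [set r : S | M (val r * s)] 1 by rewrite E.
  by rewrite /= mul1r.
move=> K [K0 KB KM] sK.
have [Ks|] := pselect (forall k, K k -> M (val k * s)).
  by left; rewrite eqEsubset.
move=> /existsNP[k /not_implyP[Kk nMks]]; right.
(* [N = M + Ks] is [I] or [M]. If it is [I], writing [s = m + is] puts [1 - i], hence [1], in [K];
   if it is [M], then [ks] lies in [M], a contradiction. *)
pose N := [set z | exists m (i : S), [/\ M m, K i & z = m + val i * s]].
have sMN : M `<=` N.
  by move=> m Mm; exists m, 0; rewrite /= mul0r addr0.
have [NI|nNI] := pselect (N = I).
  have : N s by rewrite NI.
  move=> [m [i [Mm Ki e]]].
  have K1i : K (1 - i).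
    by apply: sK; rewrite /= mulrBl mul1r {1}e addrK.
  have K1 : K 1.
    have -> : 1 = (1 - i) - (0 - i) by rewrite sub0r opprK subrK.
    by apply: (KB) => //; exact: KB.
  by rewrite -subTset => r _; rewrite -[r]mulr1; exact: KM.
have NM : N = M.
  apply: maxM => //; split=> //.
    split; first exact: sMN.
    - move=> _ _ [m [i [Mm Ki ->]]] [m' [i' [Mm' Ki' ->]]].
      exists (m - m'), (i - i'); split; [exact: MB|exact: KB|].
      by rewrite /= mulrBl opprD addrACA.
    - move=> r _ Rr [m [i [Mm Ki ->]]]; exists (r * m), (SubringType Rr * i).
      by split; [exact: MM|exact: KM|rewrite /= mulrDr mulrA].
  move=> _ [m [i [Mm Ki ->]]]; apply: (bimoduleD bI); first exact: MI.
  by apply: Il => //; exact: valP.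
case: nMks; rewrite -NM; exists 0, k; split=> //; by rewrite add0r.
Qed.

(** * Nonzero ideals of the ring: invertibility, denominators and units *)

Definition nonzero_ideal I :=
  [/\ bimodule R I, I `<=` O & exists2 x, I x & x <> 0].

Lemma nonzero_ideal_subring : nonzero_ideal O.
Proof.
split=> //; first exact: bimodule_subring.
by exists 1; [exact: rpred1|apply/eqP; exact: oner_neq0].
Qed.

Lemma nonzero_ideal_full I : (forall q, q \in R) -> nonzero_ideal I -> I 1.
Proof.
move=> AR [[I0 IB Il Ir] _ [x Ix x0]].
have [||E|->] // := hA.1.2 I; [by split; auto|by split; auto|].
by case: x0; move: Ix; rewrite E.
Qed.

(* Noetherian induction: if [1] is not in [I], then [I = P(P^-1 I)], where
   [P^-1 I] is strictly larger than [I] by Nakayama's lemma. *)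
Lemma nonzero_ideal_ind (Q : set A -> Prop) : Q O ->
  (invertible P -> forall I, nonzero_ideal I -> Q I -> Q (P ** I)) ->
  forall I, nonzero_ideal I -> Q I.
Proof.
move=> QO QP I0 iI0; apply: contrapT => nQI0.
pose F I := nonzero_ideal I /\ ~ Q I.
have [||I [iI nQI] maxI] := acc_subring_maximal (F := F) (M0 := I0) hN.1.
- move=> I [[[Iz IB Il Ir] IO _] _]; split=> //; split; rewrite /preimage /=.
  + by [].
  + by move=> x y ? ?; exact: IB.
  + by move=> r x ?; rewrite /=; apply: Il => //; exact: valP.
- by [].
have [bI IO [x Ix x0]] := iI.
have nI1 : ~ I 1.
  move=> I1; apply: nQI; suff -> : I = O by [].
  by rewrite eqEsubset; split=> //; exact: subring_sub_bimodule.
have IP : I `<=` P by apply: contrapT => /bimodule_one; auto.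
have invP : invertible P.
  apply: radical_invertible; apply: contrapT => nq; apply: nI1.
  apply: nonzero_ideal_full => // q; apply: contrapT => /negP nRq.
  by apply: nq; exists q.
have [Y [bY PY YP]] := invP.
have bYI := bimoduleM bY bI.
have PYI : P ** (Y ** I) = I by rewrite prod_setA PY prod_subring_set.
(* Otherwise [Y <= P], and then [R = YP <= P]. *)
have Y1 : Y 1.
  apply: bimodule_one => // sYP; apply: radical_not1.
  have : O 1 by exact: rpred1.
  rewrite -YP; move: (1 : A); apply: prod_set_sub.
  - by have [] := bimodule_radical.
  - by move=> ? ?; apply: bimoduleD; exact: bimodule_radical.
  - move=> y p /sYP /radical_sub Ry Pp.
    by have [_ _ Pl _] := bimodule_radical; exact: Pl.
have sIYI : I `<=` Y ** I.
  by move=> z Iz; rewrite -[z]mul1r; exact: prod_setM.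
have iYI : nonzero_ideal (Y ** I).
  split=> //; last by exists x => //; exact: sIYI.
  by rewrite -YP; exact: prod_setS.
have [QYI|nQYI] := pselect (Q (Y ** I)).
  by apply: nQI; rewrite -PYI; exact: QP.
have YI : Y ** I = I by exact: maxI.
apply: x0; apply: (nakayama bI) => //.
by rewrite -[in X in _ `<=` X]YI PYI.
Qed.

Lemma nonzero_ideal_invertible I : nonzero_ideal I -> invertible I.
Proof.
apply: nonzero_ideal_ind => [|invP J [bJ _ _]]; first exact: invertible_subring.
by apply: invertibleM => //; exact: bimodule_radical.
Qed.

Lemma invertible_nonzero I : bimodule R I -> invertible I -> exists2 x, I x & x <> 0.
Proof.
move=> bI [Z [bZ IZ _]]; apply: contrapT => nI.
have /eqP := oner_neq0 A; apply.
have : O 1 by exact: rpred1.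
rewrite -IZ; move: (1 : A); apply: prod_set_sub => //= [x y -> ->|x y Ix _].
  by rewrite addr0.
suff -> : x = 0 by rewrite mul0r.
by apply: contrapT => x0; apply: nI; exists x.
Qed.

(** This is primeness of [R]: a product of invertible ideals is invertible, hence nonzero. *)
Lemma nonzero_idealM I J :
  nonzero_ideal I -> nonzero_ideal J -> nonzero_ideal (I ** J).
Proof.
move=> iI iJ; have [bI IO _] := iI; have [bJ JO _] := iJ.
split; first exact: bimoduleM.
  rewrite -[O](prod_subring_set (bimodule_subring R)); exact: prod_setS.
apply: invertible_nonzero; first exact: bimoduleM.
by apply: invertibleM => //; exact: nonzero_ideal_invertible.
Qed.

Lemma nonzero_ideal_radical : invertible P -> nonzero_ideal P.
Proof.
move=> invP; split; [exact: bimodule_radical|exact: radical_sub|].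
by apply: invertible_nonzero => //; exact: bimodule_radical.
Qed.

(* Take a nonzero ideal [I] with [W = {r in R | I(ra) <= R}] maximal, choose
   [j] in [PI] with [ja] in [R] but not in [P], and let [Z] be the inverse of
   [PI]. Then [Zj <= W], so [ja] lies in [PI(Zj)a <= P], a contradiction. *)
Lemma nonzero_ideal_denominator a :
  exists2 I, nonzero_ideal I & forall i, I i -> i * a \in R.
Proof.
apply: contrapT => nIa.
have noden I : nonzero_ideal I -> exists2 i, I i & i * a \notin R.
  move=> iI; apply: contrapT => ni; apply: nIa; exists I => // i Ii.
  by apply: contrapT => /negP nRia; apply: ni; exists i.
pose W I := [set r | r \in R /\ forall i, I i -> i * (r * a) \in R].
pose F M := exists2 I, nonzero_ideal I & M = W I.
have [|| _ [I iI ->] maxI] := acc_subring_maximal (F := F) (M0 := W O) hN.1.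
- move=> _ [I [[_ _ _ Ir] _ _] ->]; split; last by move=> x [].
  split; rewrite /preimage /W /=.
  + by split=> [|i _]; rewrite ?rpred0 ?mul0r ?mulr0 ?rpred0.
  + move=> x y [Rx Ix] [Ry Iy]; split; first exact: rpredB.
    by move=> i Ii; rewrite mulrBl mulrBr; apply: rpredB; auto.
  + move=> r x [Rx Ix]; split.
      by apply: rpredM => //; exact: valP.
    by move=> i Ii; rewrite -[_ * a]mulrA [i * _]mulrA; apply: Ix; apply: Ir => //; exact: valP.
- by exists O => //; exact: nonzero_ideal_subring.
(* Replacing [I] by [J ** I] can only enlarge [W], so by maximality [W I] already contains every [r]
   for which some nonzero ideal [J] satisfies [J(ra) <= R]. *)
have maxW J r : nonzero_ideal J -> r \in R ->
    (forall j, J j -> j * (r * a) \in R) -> W I r.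
  move=> iJ Rr Jra; have [[J0 JB Jl Jr] _ _] := iJ; have [_ IO _] := iI.
  have <- : W (J ** I) = W I.
    apply: maxI => [|x [Rx Ix]]; first by exists (J ** I) => //; exact: nonzero_idealM.
    split=> // i; move: i; apply: prod_set_sub => [|y z|y z Jy Iz] /=.
    + by rewrite mul0r rpred0.
    + by move=> *; rewrite mulrDl; exact: rpredD.
    + by have [_ JO _] := iJ; rewrite -mulrA; apply: rpredM; [exact: JO|exact: Ix].
  split=> // i; move: i; apply: prod_set_sub => [|y z|y z Jy Iz] /=.
  + by rewrite mul0r rpred0.
  + by move=> *; rewrite mulrDl; exact: rpredD.
  + by apply: Jra; apply: Jr => //; exact: IO.
have iP : nonzero_ideal P.
  apply: nonzero_ideal_radical; apply: radical_invertible.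
  have [i _ nRia] := noden _ nonzero_ideal_subring.
  by exists (i * a).
have iPI := nonzero_idealM iP iI; have [bPI _ _] := iPI.
have [j0 PIj0 nRj0a] := noden _ iPI.
have [r Rr [Rja nPja]] := left_quotient nRj0a.
have {Rr PIj0} PIj : (P ** I) (r * j0) by have [_ _ PIl _] := bPI; exact: PIl.
rewrite mulrA in Rja nPja; move: (r * j0) PIj Rja nPja => j PIj Rja nPja {j0 nRj0a r}.
have [Z [bZ PIZ ZPI]] := nonzero_ideal_invertible iPI.
(* Here [PI] serves as the denominator: [(PI)z <= R] and [ja] is in [R]. *)
have WZj z : Z z -> W I (z * j).
  move=> Zz; apply: (maxW (P ** I)) => //.
    suff : O (z * j) by [].
    by rewrite -ZPI; exact: prod_setM.
  move=> x PIx; rewrite -[z * j * a]mulrA mulrA; apply: rpredM => //.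
  suff : O (x * z) by [].
  by rewrite -PIZ; exact: prod_setM.
apply: nPja; rewrite -[j * a]mul1r.
have [P0 _ _ Pr] := bimodule_radical.
have : O 1 by exact: rpred1.
rewrite -PIZ -prod_setA; move: (1 : A).
apply: prod_set_sub => [|x y|p y Pp].
- by rewrite mul0r.
- by move=> Px Py; rewrite mulrDl; apply: bimoduleD => //; exact: bimodule_radical.
move=> IZy; rewrite -mulrA; apply: Pr => //; move: y IZy.
apply: prod_set_sub => [|x y|i z Ii /WZj[_ Iz]] /=.
- by rewrite mul0r rpred0.
- by move=> *; rewrite mulrDl; exact: rpredD.
- by rewrite -mulrA [z * _]mulrA; exact: Iz.
Qed.

(* Otherwise the left ideal [C] of [A] lies in [P], so it is quasi-regular,
   which is impossible for a nonzero left ideal of [A]. *)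
Lemma left_ideal_bimodule_full (C : set A) :
  left_ideal C -> (forall r x, r \in R -> C x -> C (x * r)) ->
  (exists2 x, C x & x <> 0) -> C 1.
Proof.
move=> lC Cr nC; have [C0 CB CM] := lC.
apply: bimodule_one => [|CP]; first by split=> // r x _; exact: CM.
pose F M := [/\ left_ideal M, M `<=` C & exists2 x : A, M x & x <> 0].
have [||D [[D0 DB DM] DC [x Dx x0]] minD] :=
    dcc_minimal (F := F) (M0 := C) hA.2.1.
- by move=> M [].
- by split.
(* Otherwise the left annihilator of [D], a two-sided ideal, contains the nonzero [x]; by simplicity
   it contains [1], so [D] is zero. *)
have [y [Dy xy0]] : exists y, D y /\ x * y <> 0.
  apply: contrapT => nxy.
  pose B := [set z | forall y, D y -> z * y = 0].
  have lB : left_ideal B.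
    split=> [y _|u v Bu Bv y Dy|u v Bv y Dy]; first by rewrite mul0r.
      by rewrite mulrBl Bu // Bv // subrr.
    by rewrite -mulrA Bv // mulr0.
  have rB : right_ideal B.
    split=> [y _|u v Bu Bv y Dy|u v Bv y Dy]; first by rewrite mul0r.
      by rewrite mulrBl Bu // Bv // subrr.
    by rewrite -mulrA; apply: Bv; exact: DM.
  have Bx : B x.
    by move=> y Dy; apply: contrapT => xy0; apply: nxy; exists y.
  have [E|E] := hA.1.2 _ lB rB; first by apply: x0; rewrite E in Bx.
  have /(_ x Dx) : B 1 by rewrite E.
  by rewrite mul1r.
(* By minimality [Dy = D], so [y = ey] with [e] in [D], hence in [P]; as [1 - e] is left invertible,
   [y = 0]. *)
have Dy' : [set z * y | z in D] = D.
  apply: minD; last by move=> _ [z Dz <-]; exact: DM.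
  split.
  - split; first by exists 0; rewrite ?mul0r.
    + by move=> _ _ [u Du <-] [v Dv <-]; exists (u - v); [exact: DB|rewrite mulrBl].
    + by move=> r _ [u Du <-]; exists (r * u); [exact: DM|rewrite mulrA].
  - by move=> _ [z Dz <-]; apply: DC; exact: DM.
  - by exists (x * y) => //; exists x.
have : D y by [].
rewrite -{1}Dy' => -[e De ey].
have [u _ u1] := radical_inverse (CP _ (DC _ De)).
by apply: xy0; rewrite -[y]mul1r -u1 -mulrA mulrBl mul1r ey subrr !mulr0.
Qed.

(* Goldie's argument: an element of [P] with minimal left annihilator. *)
Lemma radical_unit : invertible P ->
  exists2 c, P c & exists2 d, d * c = 1 & c * d = 1.
Proof.
move=> invP; have bP := bimodule_radical; have [P0 _ Pl Pr] := bP.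
pose ann c := [set a : A | a * c = 0].
pose F M := exists2 c, P c & M = ann c.
have [||_ [c Pc ->] minc] := dcc_minimal (F := F) (M0 := ann 0) hA.2.1.
- move=> _ [c _ ->]; split; rewrite /ann /=; first by rewrite mul0r.
    by move=> x y xc yc; rewrite mulrBl xc yc subrr.
  by move=> r x xc; rewrite -mulrA xc mulr0.
- by exists 0.
exists c => //; apply: (dcc_left_cancel hA.2.1) => b bc0.
apply: contrapT => b0.
(* [Ac] is not essential: otherwise it would contain [1], and a left invertible [c] is not
   annihilated by a nonzero [b]. So some nonzero [y] has [Ay] meeting [Ac] trivially. *)
have [y0 y00 ycap0] : exists2 y, y <> 0 &
    forall r, (exists u, r * y = u * c) -> r * y = 0.
  apply: contrapT => ny.
  have [x x0|u uc1] := essential_left_ideal_full hA.1 hA.2.1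
    (left_ideal_principal c).
  - apply: contrapT => nr; apply: ny; exists x => // r [u e].
    by apply: contrapT => rx0; apply: nr; exists r => //; exists u.
  - by apply: b0; apply: (dcc_left_inverse hA.2.1 (esym uc1)).
have [y [Ry ny0 ycap]] : exists y, [/\ y \in R, y <> 0 &
    forall r, (exists u, r * y = u * c) -> r * y = 0].
  have [Ry|/left_quotient[r Rr [Rry nPry]]] := boolP (y0 \in R); first by exists y0.
  exists (r * y0); split=> // [ry0|s]; last by rewrite mulrA; exact: ycap0.
  by apply: nPry; rewrite ry0.
(* If [bPy = 0], the left annihilator of [Py] contains [b], so it is all of [A] and [Py = 0]. Then
   that of [Ry] contains [P], so it too is all of [A] and [y = 0]. *)
have [b' [p [b'c Pp b'py]]] :
    exists b' p, [/\ b' * c = 0, P p & b' * (p * y) <> 0].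
  apply: contrapT => nbp; apply: ny0; rewrite -[y]mul1r -[1 * y]mul1r.
  pose D := [set a | forall r, r \in R -> a * (r * y) = 0].
  suff : D 1 by apply; exact: rpred1.
  have lD K : left_ideal [set a | forall r, K r -> a * (r * y) = 0].
    split=> [r _|u v Bu Bv r Dy|u v Bv r Dy]; first by rewrite mul0r.
      by rewrite mulrBl Bu // Bv // subrr.
    by rewrite -mulrA Bv // mulr0.
  apply: left_ideal_bimodule_full; first exact: (lD [set` R]).
    by move=> r x Rr Dx s Rs; rewrite -mulrA [r * _]mulrA; apply: Dx; exact: rpredM.
  have [x Px x0] := invertible_nonzero bP invP.
  exists x => // r Rr.
  suff : [set a | forall p, P p -> a * (p * y) = 0] 1.
    by move=> /(_ (x * r) (Pr _ _ Rr Px)); rewrite mul1r mulrA.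
  apply: left_ideal_bimodule_full; first exact: lD.
    by move=> s z Rs Dz p Pp; rewrite -mulrA [s * _]mulrA; apply: Dz; exact: Pl.
  exists b => // p Pp; apply: contrapT => bpy; apply: nbp.
  by exists b, p.
(* If [a] annihilates [c + py], then [ac = -apy] lies in both [Ac] and [Ay], so it is zero;
   minimality gives equality, which [b'] contradicts. *)
have E : ann (c + p * y) = ann c.
  apply: minc.
    exists (c + p * y) => //; apply: (bimoduleD bP) => //; exact: Pr.
  move=> a; rewrite /ann /= mulrDr => /eqP; rewrite addr_eq0 => /eqP ac.
  rewrite ac mulrA ycap ?oppr0 //; exists (- a).
  by rewrite mulNr ac opprK mulrA.
apply: b'py; have : ann c b' by [].
by rewrite -E /ann /= mulrDr b'c add0r.
Qed.

(** The induction reaches every nonzero ideal from [R] by multiplying by [P], and units of [A]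
    multiply. *)
Lemma nonzero_ideal_unit I : nonzero_ideal I ->
  exists2 c, I c & exists2 d, d * c = 1 & c * d = 1.
Proof.
move: I; apply: nonzero_ideal_ind.
  by exists 1; [exact: rpred1|exists 1; rewrite mul1r].
move=> invP I _ [c Ic [d dc cd]].
have [p Pp [q qp pq]] := radical_unit invP.
exists (p * c); first exact: prod_setM.
exists (d * q).
  by rewrite -mulrA [q * _]mulrA qp mul1r.
by rewrite -mulrA [c * _]mulrA cd mul1r.
Qed.

(** * Fractional ideals and their inverses *)

Lemma regular_unit (c : S) d : d * val c = 1 -> val c * d = 1 -> regular c.
Proof.
move=> dc cd; split=> x y /(congr1 val); rewrite /= => e.
  apply: val_inj => /=.
  by rewrite -[LHS]mul1r -dc -mulrA e mulrA dc mul1r.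
apply: val_inj => /=.
by rewrite -[LHS]mulr1 -cd mulrA e -mulrA cd mulr1.
Qed.

Lemma bimodule_denominators I : bimodule R I ->
  bimodule R [set x | forall i, I i -> x * i \in R].
Proof.
move=> [I0 IB Il Ir]; split.
- by move=> i _; rewrite mul0r rpred0.
- by move=> x y Ix Iy i Ii; rewrite mulrBl; apply: rpredB; auto.
- by move=> r x Rr Ix i Ii; rewrite -mulrA; apply: rpredM; auto.
- by move=> r x Rr Ix i Ii; rewrite -mulrA; apply: Ix; exact: Il.
Qed.

Lemma bimodule_numerators I : bimodule R I ->
  bimodule R [set x | forall i, I i -> i * x \in R].
Proof.
move=> [I0 IB Il Ir]; split.
- by move=> i _; rewrite mulr0 rpred0.
- by move=> x y Ix Iy i Ii; rewrite mulrBr; apply: rpredB; auto.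
- by move=> r x Rr Ix i Ii; rewrite mulrA; apply: Ix; exact: Ir.
- by move=> r x Rr Ix i Ii; rewrite mulrA; apply: rpredM; auto.
Qed.

(** A unit [c] in a denominator ideal of [a] satisfies [c(RaR) <= R]. The regular element is a unit
    inside the nonzero ideal [R(ca)R], which lies in [RaR]. *)
Lemma fractional_bimodule_gen a : a != 0 -> fractional R (bimodule_gen R a).
Proof.
move=> a0; have ba := bimodule_genP R a; have [_ _ al ar] := ba.
have [I iI Ia] := nonzero_ideal_denominator a.
have [c Ic [d dc cd]] := nonzero_ideal_unit iI.
have [bI IO _] := iI; have Rc := IO _ Ic.
have Ica := Ia _ Ic.
split=> //.
  have ica : nonzero_ideal (bimodule_gen R (c * a)).
    split; first exact: bimodule_genP.
      by apply: bimodule_gen_sub => //;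
  exact: bimodule_subring.
    exists (c * a); first exact: mem_bimodule_gen.
    move=> ca0; move/eqP: a0; apply.
    by rewrite -[a]mul1r -dc -mulrA ca0 mulr0.
  have [e cae [f fe ef]] := nonzero_ideal_unit ica.
  have [_ caO _] := ica.
  exists (SubringType (caO _ cae)); first exact: (regular_unit (d := f)).
  apply: (bimodule_gen_sub ba _ cae); apply: al => //; exact: mem_bimodule_gen.
exists (SubringType Rc); first exact: (regular_unit (d := d)).
move=> x /(bimodule_gen_sub (bimodule_numerators bI) Ia); exact.
Qed.

(** If [rI <= R] and [G = RrR], both [G] and [GI] are nonzero ideals of [R], and [I] is the inverse
    of [G] times [GI]. *)
Lemma fractional_invertible I : fractional R I -> invertible I.
Proof.
move=> [bI [s regs Is] [r regr rI]].
set G := bimodule_gen R (val r).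
have bG : bimodule R G by exact: bimodule_genP.
have nz0 (x : S) : regular x -> val x <> 0.
  move=> [lx _] x0; have /eqP := oner_neq0 S; apply; apply: lx.
  by apply: val_inj; rewrite /= x0 !mul0r.
have iG : nonzero_ideal G.
  split=> //; first by apply: bimodule_gen_sub; [exact: bimodule_subring|exact: valP].
  by exists (val r); [exact: mem_bimodule_gen|exact: nz0].
have iGI : nonzero_ideal (G ** I).
  split; first exact: bimoduleM.
    apply: prod_set_sub => [|x y|x y Gx] /=; [exact: rpred0|exact: rpredD|].
    exact: (bimodule_gen_sub (bimodule_denominators bI) rI Gx).
  exists (val r * val s); first by apply: prod_setM => //; exact: mem_bimodule_gen.
  by rewrite -[val r * val s]/(val (r * s)); apply: nz0; exact: regularM.
have [Z [bZ GZ ZG]] := nonzero_ideal_invertible iG.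
have -> : I = Z ** (G ** I) by rewrite prod_setA ZG prod_subring_set.
apply: invertibleM => //; [exact: bimoduleM|by exists G|].
exact: nonzero_ideal_invertible.
Qed.

(** The two regular elements exchange roles: [r] lies in [rIZ <= Z], and [sZ <= IZ = R]. *)
Lemma fractional_inverse I : fractional R I ->
  exists2 Z, fractional R Z & I ** Z = O /\ Z ** I = O.
Proof.
move=> fI; have [Z [bZ IZ ZI]] := fractional_invertible fI.
have [bI [s regs Is] [r regr rI]] := fI.
exists Z => //; split=> //.
  exists r => //.
  have : O 1 by exact: rpred1.
  rewrite -[val r]mulr1 -IZ; move: (1 : A); have [Z0 _ Zl _] := bZ.
  apply: prod_set_sub => [|x y|x y Ix Zy].
  - by rewrite mulr0.
  - by move=> *; rewrite mulrDr; exact: (bimoduleD bZ).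
  - by rewrite mulrA; apply: Zl => //; exact: rI.
exists s => // x Zx; suff : O (val s * x) by [].
by rewrite -IZ; exact: prod_setM.
Qed.

(** With [Z] the inverse of [I], one has [PZ <= (P : I)]. So [(P : I)x <= P] gives [P(Zx) <= P],
    then [Zx <= R], and [x] lies in [IZx <= I]. *)
Lemma colon_colon I : fractional R I ->
  I = [set x | forall a, left_colon P I a -> P (a * x)].
Proof.
move=> fI; have [bI _ _] := fI; have [Z [bZ IZ ZI]] := fractional_invertible fI.
rewrite eqEsubset; split=> [x Ix a|x Px]; first exact.
have sZ z : Z z -> z * x \in R.
  move=> Zz; apply: radical_right_order => p Pp; rewrite mulrA.
  apply: Px => y Iy; rewrite -mulrA.
  have [_ _ _ Pr] := bimodule_radical; apply: Pr => //.
  suff : O (z * y) by [].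
  by rewrite -ZI; exact: prod_setM.
rewrite -[x]mul1r; have : O 1 by exact: rpred1.
rewrite -IZ; move: (1 : A); have [I0 _ _ Ir] := bI.
apply: prod_set_sub => [|y z|y z Iy Zz].
- by rewrite mul0r.
- by move=> *; rewrite mulrDl; exact: (bimoduleD bI).
- by rewrite -mulrA; apply: Ir => //; exact: sZ.
Qed.

(** * Order and equality of values *)

Lemma value_leP (I J : frac_ideal R) :
  value_le (value I) (value J) <-> frac_carrier J `<=` frac_carrier I.
Proof.
split=> [le_IJ x Jx|sJI a Ia x /sJI]; last exact: Ia.
rewrite (colon_colon (fracP I)) => a /le_IJ; exact.
Qed.

Lemma value_eqP (I J : frac_ideal R) :
  value I = value J <-> frac_carrier I = frac_carrier J.
Proof.
split=> [E|E]; last by apply: val_inj; rewrite /= E.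
by rewrite eqEsubset; split; apply/value_leP; rewrite E => x.
Qed.

Lemma value_surj (g : value_group R) : exists I : frac_ideal R, value I = g.
Proof.
by have [I E] := set_mem (valP g); exists I; apply: val_inj; rewrite /= -E.
Qed.

(** The inverse of [J] times [I] is comparable with [R]; multiplying by [J] compares [I] with
    [J]. *)
Lemma frac_ideal_comparable (I J : frac_ideal R) :
  frac_carrier I `<=` frac_carrier J \/ frac_carrier J `<=` frac_carrier I.
Proof.
have [bI _ _] := fracP I; have [bJ _ _] := fracP J.
have [Z [bZ JZ _]] := fractional_invertible (fracP J).
have JZI : J ** (Z ** I) = I by rewrite prod_setA JZ prod_subring_set.
have [ZI|ZI] := bimodule_comparable (bimoduleM bZ bI).
  left; rewrite -JZI -[X in _ `<=` X](prod_set_subring bJ).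
  exact: prod_setS.
right; rewrite -JZI -[X in X `<=` _](prod_set_subring bJ).
exact: prod_setS.
Qed.

Lemma colon_radical_subring : left_colon P O = P.
Proof.
rewrite eqEsubset; split=> [a /(_ 1 (rpred1 R))|a Pa x Rx].
  by rewrite mulr1.
by have [_ _ _ Pr] := bimodule_radical; exact: Pr.
Qed.

Lemma frac_gen_sub a (I : frac_ideal R) :
  frac_carrier I = bimodule_gen R a -> frac_carrier I `<=` O <-> a \in R.
Proof.
move=> ->; split=> [sO|Ra]; first exact: (sO _ (mem_bimodule_gen R a)).
exact: (bimodule_gen_sub (bimodule_subring R)).
Qed.

Lemma value_gen_ge0 : O = [set a | value_gen_ge a (value (frac_one R))].
Proof.
rewrite eqEsubset; split=> [a Ra|a [->|[I [E /value_leP sI]]]].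
- have [->|a0] := eqVneq a 0; first by left.
  right; exists (FracIdeal (fractional_bimodule_gen a0)); split=> //.
  by apply/value_leP; apply/(frac_gen_sub (a := a)).
- exact: rpred0.
- by apply/(frac_gen_sub E).
Qed.

Lemma value_gen_gt0 : P = [set a | value_gen_gt a (value (frac_one R))].
Proof.
have bP := bimodule_radical.
rewrite eqEsubset; split=> [a Pa|a [->|[I [E [/value_leP sI neI]]]]].
- have [->|a0] := eqVneq a 0; first by left.
  right; exists (FracIdeal (fractional_bimodule_gen a0)); split=> //; split.
    by apply/value_leP; apply/(frac_gen_sub (a := a)) => //; exact: radical_sub.
  move=> /value_eqP /= Egen; apply: radical_not1.
  apply: (bimodule_gen_sub bP Pa); rewrite -Egen /=; exact: rpred1.
- by have [] := bP.
- have [bI _ _] := fracP I.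
  suff sIP : frac_carrier I `<=` P.
    by apply: sIP; rewrite E; exact: mem_bimodule_gen.
  (* If [I] is not inside [P] it contains [1], so [I = R], against strictness. *)
  apply: contrapT => /(bimodule_one bI) I1; apply: neI.
  by apply/value_eqP; rewrite eqEsubset; split=> //; exact: subring_sub_bimodule.
Qed.

End Dubrovin.

(** * The ordered group of values and the pseudo-valuation *)

Theorem corollary4p2 (A : nzRingType) (R : subringClosed A)
    (hA : simple_artinian A) (hR : dubrovin_valuation_ring R)
    (hN : noetherian (subring_type R)) :
  let zero := value (frac_one R) in
  exists add : value_group R -> value_group R -> value_group R,
    [/\ val zero = radical R,
        arithmetical_pseudo_valuation (@value_le A R) add zero (@value A R)
        /\ totally_ordered_group (@value_le A R) add zero,
        forall a : A, a != 0 -> fractional R (bimodule_gen R a),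
        radical R = [set a | value_gen_gt a zero]
      & [set` R] = [set a | value_gen_ge a zero]].
Proof.
move=> zero; have [rep repK] := choice (@value_surj A R).
pose add g h := value (frac_mul (rep g) (rep h)); exists add.
have leP := value_leP hA hR hN; have eqP := value_eqP hA hR hN.
(* Equal values come from equal ideals, so the sum does not depend on the representatives chosen by
   [rep]. *)
have addE I J : add (value I) (value J) = value (frac_mul I J).
  apply/eqP; rewrite /=.
  by congr prod_set; apply/eqP; rewrite repK.
have frac_bimodule (I : frac_ideal R) : bimodule R I by have [] := fracP I.
have po : partial_order (@value_le A R).
  split=> [x y|x y xy yx|x y z xy yz a /xy /yz] //.
  by apply: val_inj; rewrite eqEsubset.
have posg : partially_ordered_semigroup (@value_le A R) add zero.
  split=> //.
  - move=> x y z; rewrite -(repK x) -(repK y) -(repK z) !addE.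
    by apply/eqP; exact: prod_setA.
  - split=> x; rewrite -(repK x) addE; apply/eqP.
      exact: prod_subring_set.
    exact: prod_set_subring.
  - move=> x y z; rewrite -(repK x) -(repK y) -(repK z) !addE => /leP sxy.
    by split; apply/leP; exact: prod_setS.
have tot (I J : frac_ideal R) := frac_ideal_comparable hA hR hN I J.
split.
- exact: colon_radical_subring.
- split; split=> //.
  + split=> //.
    (* By comparability [I + J] is the larger of the two ideals, so it is fractional. *)
    * move=> I J; have [sIJ|sJI] := tot I J.
        exists J => //; rewrite eqEsubset; split=> [x Jx|_ [x [y [Ix Jy ->]]]].
          by exists 0, x; split=> //; [have [] := frac_bimodule I|rewrite add0r].
        by apply: (bimoduleD (frac_bimodule J)) => //; exact: sIJ.
      exists I => //; rewrite eqEsubset; split=> [x Jx|_ [x [y [Ix Jy ->]]]].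
        by exists x, 0; split=> //; [have [] := frac_bimodule J|rewrite addr0].
      by apply: (bimoduleD (frac_bimodule I)) => //; exact: sJI.
    * by move=> I J /leP.
  + move=> x y; rewrite -(repK x) -(repK y).
    by have [/leP|/leP] := tot (rep x) (rep y); [right|left].
  + move=> x; rewrite -(repK x).
    have [Z fZ [IZ ZI]] := fractional_inverse hA hR hN (fracP (rep x)).
    by exists (value (FracIdeal fZ)); rewrite !addE; split; apply/eqP.
- exact: fractional_bimodule_gen.
- exact: value_gen_gt0.
- exact: value_gen_ge0.
Qed.
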